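(* Let $\varphi$ be a VB-convex function on a finite-dimensional real Hilbert space $\mathbb H$. Then the volumetric barrier associated with $\varphi$, $$\mathrm{VB}_\varphi(x):=\tfrac12\log\det\nabla^2\varphi(x),\qquad x\in\operatorname{dom}\varphi,$$ is a convex function on $\operatorname{dom}\varphi$.
   Context: Let $\mathbb H$ be a real Hilbert space. A function $\varphi$ with open convex domain $\operatorname{dom}\varphi\subseteq\mathbb H$, real-valued and $C^4$ on $\operatorname{dom}\varphi$, is called VB-convex if it is strictly convex and $$D^4\varphi(x)[u,u,v,v]\;D^2\varphi(x)[v,v]\ \ge\ \tfrac32\left(D^3\varphi(x)[u,v,v]\right)^2\qquad\forall x\in\operatorname{dom}\varphi,\ u,v\in\mathbb H.$$ Here $D^k\varphi(x)[\cdot,\dots,\cdot]$ is the $k$-th derivative of $\varphi$ at $x$ as a symmetric multilinear form, and $\nabla^2\varphi(x):\mathbb H\to\mathbb H$ is the Hessian, $\langle v,\nabla^2\varphi(x)u\rangle=D^2\varphi(x)[v,u]$. *)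

(* Defs.v *)
From HB Require Import structures.
From mathcomp Require Import all_boot all_order all_algebra.
From mathcomp Require Import all_classical all_reals all_analysis.
From mathcomp Require Import sesquilinear.

Set Implicit Arguments.
Unset Strict Implicit.
Unset Printing Implicit Defensive.

Import Order.TTheory GRing.Theory Num.Theory.
Import numFieldNormedType.Exports.

Local Open Scope classical_set_scope.
Local Open Scope ring_scope.
Local Open Scope convex_scope.

HB.mixin Record NormedModule_hasInner (R : realType) H & NormedModule R H := {
  inner : {dot H for idfun} ;
  inner_norm : forall x : H, inner x x = `|x| ^+ 2
}.

(* No completeness is required: it is automatic in finite dimension. *)
#[short(type="finHilbertType")]
HB.structure Definition FinHilbert (R : realType) :=
  {H of NormedModule R H & Vector R H & NormedModule_hasInner R H}.

Section VBConvex.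
Context {R : realType} {H : finHilbertType R}.
Implicit Types (D : set H) (phi : H -> R) (x u v : H).

(* In finite dimension the map x |-> 'd phi x into the dual space is C^k iff
   x |-> 'd phi x u is C^k for each fixed u; this avoids norming the spaces
   of multilinear forms. [D] is meant to be open. *)
Fixpoint Ck (k : nat) D phi : Prop :=
  if k is k'.+1 then
    (forall x, D x -> differentiable phi x) /\
    (forall u, Ck k' D (fun x => 'd phi x u))
  else forall x, D x -> {for x, continuous phi}.

(* [Dn phi [:: u1; ...; uk] x] is D^k phi(x)[u1, ..., uk]. *)
Fixpoint Dn phi (us : seq H) : H -> R :=
  if us is u :: us' then fun x => 'd (Dn phi us') x u else phi.

Definition strictly_convex_function D phi : Prop :=
  forall t : {i01 R}, 0 < t%:num < 1 ->
    {in D &, forall x y : convex_lmodType H, x != y ->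
      (phi (x <| t |> y) < (phi x : R^o) <| t |> phi y)%R}.

Definition VB_convex D phi : Prop :=
  [/\ open D, @convex_set R H D, Ck 4 D phi,
      strictly_convex_function D phi
    & forall x u v, D x ->
        Dn phi [:: u; u; v; v] x * Dn phi [:: v; v] x
          >= 3 / 2 * Dn phi [:: u; v; v] x ^+ 2].

Definition is_hessian phi x (A : 'End(H)) : Prop :=
  forall u v, inner v (A u) = Dn phi [:: v; u] x.

Definition hessian phi x : 'End(H) := xget 0 [set A | is_hessian phi x A].

(* The determinant does not depend on the basis. *)
Definition det_lfun (A : 'End(H)) : R :=
  \det (passmx.mxof (vbasis {:H}) (vbasis {:H}) A).

(* [ln] is total, with value 0 off the positive reals, so this is meaningful
   only where the determinant is positive. *)
Definition volumetric_barrier phi x : R :=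
  2^-1 * ln (det_lfun (hessian phi x)).

Lemma innerC x y : inner x y = inner y x.
Proof. by rewrite [LHS](hermitian_subproof (s := @inner R H)) expr0 mul1r. Qed.

Lemma innerBl x y w : inner (x - y) w = inner x w - inner y w.
Proof. exact: linearBl. Qed.

Lemma innerBr w x y : inner w (x - y) = inner w x - inner w y.
Proof. exact: linearBr. Qed.

Lemma inner_gt0 x : x != 0 -> 0 < inner x x.
Proof. by move=> x0; rewrite inner_norm exprn_gt0 ?normr_gt0. Qed.

Lemma is_hessian_uniq phi x (A B : 'End(H)) :
  is_hessian phi x A -> is_hessian phi x B -> A = B.
Proof.
move=> hA hB; apply/lfunP => u; apply/eqP; rewrite -subr_eq0.
apply/negPn/negP => /inner_gt0.
by rewrite innerBr hA hB subrr ltxx.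
Qed.

Lemma riesz (G : H -> {linear H -> R^o}) :
  (forall v, linear (fun u => G u v : R^o)) ->
  exists A : 'End(H), forall u v, inner v (A u) = G u v.
Proof.
move=> Glin.
pose F0 (w : H) : 'Hom(H, R^o) := linfun (inner w : H -> R^o).
have F0E w v : F0 w v = inner w v by rewrite /F0 lfunE.
have F0lin : linear F0.
  move=> a x y; apply/lfunP => v.
  by rewrite F0E [RHS]lfunE/= [(a *: F0 x) v]lfunE/= !F0E linearPl.
pose F0a := GRing.isLinear.Build _ _ _ _ F0 F0lin.
pose F0L : {linear H -> 'Hom(H, R^o)} := HB.pack F0 F0a.
pose F := linfun F0L.
pose G0 (u : H) : 'Hom(H, R^o) := linfun (G u).
have G0E u v : G0 u v = G u v by rewrite /G0 lfunE.
have G0lin : linear G0.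
  move=> a x y; apply/lfunP => v.
  by rewrite G0E [RHS]lfunE/= [(a *: G0 x) v]lfunE/= !G0E Glin.
pose G0a := GRing.isLinear.Build _ _ _ _ G0 G0lin.
pose G0L : {linear H -> 'Hom(H, R^o)} := HB.pack G0 G0a.
have FE w : F w = F0 w by rewrite /F lfunE.
have kF : lker F == 0%VS.
  apply/lker0P => x y /lfunP/(_ (x - y)); rewrite !FE !F0E => xy.
  apply/eqP; rewrite -subr_eq0; apply/negPn/negP => /inner_gt0.
  by rewrite innerBl xy subrr ltxx.
have imF : limg F = fullv.
  apply/eqP; rewrite eqEdim subvf/= limg_dim_eq ?(eqP kF) ?capv0//.
  by rewrite !dimvf/= /dim/= muln1.
exists (F^-1 \o linfun G0L)%VF => u v.
rewrite comp_lfunE [linfun G0L u]lfunE/= innerC -F0E -FE limg_lfunVK ?G0E//.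
by rewrite imF memvf.
Qed.

Lemma hessianP D phi x : D x -> Ck 2 D phi -> is_hessian phi x (hessian phi x).
Proof.
move=> Dx [dphi ddphi].
suff [A hA] : exists A, is_hessian phi x A by exact: (xgetPex 0 (ex_intro _ A hA)).
apply: (@riesz (fun u => 'd (fun y => 'd phi y u) x)) => v a u w /=.
have -> : (fun y => 'd phi y (a *: u + w)) =
    a *: (fun y => 'd phi y u : R^o) + (fun y => 'd phi y w).
  by apply/funext => y; rewrite linearP.
have du z : differentiable (fun y => 'd phi y z) x by apply: (ddphi z).1.
by rewrite diffD ?diffZ//; exact: differentiableZ.
Qed.

End VBConvex.

(* Main.v *)
(* By Hadamard's inequality, [ln \det M] is the minimum of
   [\sum_i ln M(v_i, v_i)] over the bases [v] of determinant one, attained at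
   any such basis that diagonalises [M].  Given [x] and [y], a basis
   diagonalising both Hessians reduces convexity of [ln \det] between [x] and
   [y] to convexity of [z |-> ln (D^2 phi(z)[v, v])] for each fixed [v], and
   this is the inequality [D^4[u,u,v,v] D^2[v,v] >= (D^3[u,v,v])^2].

   The Hessian is nondegenerate: if [D^2 phi(x)[v, v] = 0], log-convexity of
   [D^2[v,v]] along the line [x + t v] makes it vanish on a segment, which
   strict convexity forbids. *)
Require Import Defs.
From mathcomp Require Import all_boot all_order all_algebra.
From mathcomp Require Import all_classical all_reals all_analysis.
From mathcomp Require Import ring lra.

Set Implicit Arguments.
Unset Strict Implicit.
Unset Printing Implicit Defensive.

Import Order.TTheory GRing.Theory Num.Theory.
Import numFieldNormedType.Exports.

Local Open Scope classical_set_scope.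
Local Open Scope ring_scope.

(** * Positive definite forms, Schur complements and determinants *)

Section QuadraticForm.
Context {R : realType}.

Definition qform n (S : 'M[R]_n) (v : 'rV[R]_n) : R := (v *m S *m v^T) 0 0.

Definition posdef n (S : 'M[R]_n) : Prop :=
  S^T = S /\ forall v, v != 0 -> 0 < qform S v.

Lemma qformE n (S : 'M[R]_n) v :
  qform S v = \sum_j (\sum_i v 0 i * S i j) * v 0 j.
Proof. by rewrite /qform mxE; apply: eq_bigr => j _; rewrite !mxE. Qed.

Lemma qformZ n (S : 'M[R]_n) a v : qform S (a *: v) = a ^+ 2 * qform S v.
Proof. by rewrite /qform linearZ/= -!scalemxAl -scalemxAr scalerA mxE. Qed.

Lemma qformD n (S : 'M[R]_n) v w : S^T = S ->
  qform S (v + w) = qform S v + qform S w + (v *m S *m w^T) 0 0 *+ 2.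
Proof.
move=> Ssym.
have wv : (w *m S *m v^T) 0 0 = (v *m S *m w^T) 0 0.
  by rewrite -[w *m S *m v^T]trmxK mxE !trmx_mul trmxK Ssym mulmxA.
rewrite /qform linearD/= mulmxDr !mulmxDl.
rewrite [LHS]mxE [X in X + _ = _]mxE [X in _ + X = _]mxE wv; ring.
Qed.

Lemma qform_congr n (S U : 'M[R]_n) v :
  qform (U *m S *m U^T) v = qform S (v *m U).
Proof. by rewrite /qform trmx_mul !mulmxA. Qed.

Lemma posdef_congr n (S U : 'M[R]_n) :
  U \in unitmx -> posdef S -> posdef (U *m S *m U^T).
Proof.
move=> Uu [Ssym Spos]; split; first by rewrite !trmx_mul trmxK Ssym mulmxA.
move=> v v0; rewrite qform_congr Spos//; apply: contraNneq v0 => vU0.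
by rewrite -(mulmxK Uu v) vU0 mul0mx.
Qed.

Definition schur n (S : 'M[R]_(1 + n)) : 'M[R]_n :=
  drsubmx S - (S 0 0)^-1 *: (dlsubmx S *m ursubmx S).

Lemma posdef00 n (S : 'M[R]_(1 + n)) : posdef S -> 0 < S 0 0.
Proof.
move=> [_ /(_ (delta_mx 0 0))]; rewrite /qform -rowE trmx_delta -colE !mxE.
apply; apply/eqP => /matrixP/(_ 0 0); rewrite !mxE eqxx => /eqP.
by rewrite oner_eq0.
Qed.

Lemma ulsubmx00 n (S : 'M[R]_(1 + n)) : ulsubmx S = (S 0 0)%:M.
Proof.
rewrite [LHS]mx11_scalar; congr _%:M; rewrite !mxE.
by congr (S _ _); apply/val_inj.
Qed.

(** A unitriangular factor on the right clears the first row beyond the corner, leaving a block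
    lower triangular matrix. *)
Lemma det_schur n (S : 'M[R]_(1 + n)) :
  S 0 0 != 0 -> \det S = S 0 0 * \det (schur S).
Proof.
move=> a0.
have /(congr1 determinant) :
    S *m block_mx 1%:M (- (S 0 0)^-1 *: ursubmx S) 0 1%:M =
    block_mx (S 0 0)%:M 0 (dlsubmx S) (schur S).
  rewrite -{1}[S]submxK mulmx_block !mulmx0 !mulmx1 !addr0 ulsubmx00.
  rewrite mul_scalar_mx scalerA mulrN divff// scaleN1r addNr.
  by rewrite -scalemxAr scaleNr addrC.
by rewrite det_mulmx det_ublock det_lblock !det1 !mulr1 det_scalar1.
Qed.

(** Completion of the square in the first coordinate [x]. *)
Lemma qform_schur n (S : 'M[R]_(1 + n)) x (w : 'rV_n) :
    S^T = S -> S 0 0 != 0 ->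
  qform S (row_mx x%:M w) =
  S 0 0 * (x + (S 0 0)^-1 * (ursubmx S *m w^T) 0 0) ^+ 2 + qform (schur S) w.
Proof.
move=> Ssym a0.
have Sdl : dlsubmx S = (ursubmx S)^T by rewrite -[in LHS]Ssym trmx_ursub.
rewrite /qform /schur -{1}[S]submxK mul_row_block tr_row_mx mul_row_col.
rewrite ulsubmx00 Sdl tr_scalar_mx !mul_scalar_mx !mul_mx_scalar.
have wb : w *m (ursubmx S)^T = ((ursubmx S *m w^T) 0 0)%:M.
  by rewrite -[LHS]trmxK trmx_mul trmxK [X in X^T]mx11_scalar tr_scalar_mx.
rewrite mulmxBr mulmxBl -scalemxAr -scalemxAl (mulmxA w) wb -(mulmxA _%:M).
rewrite !mulmxDl ?mul_scalar_mx -!scalemxAl.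
move: (ursubmx S *m w^T) (w *m drsubmx S *m w^T) => q r.
by rewrite !mxE eqxx !mulr1n; field.
Qed.

Lemma schur_sym n (S : 'M[R]_(1 + n)) : S^T = S -> (schur S)^T = schur S.
Proof.
move=> Ssym; rewrite /schur linearB linearZ/= trmx_mul.
by rewrite trmx_dlsub trmx_ursub trmx_drsub Ssym.
Qed.

Lemma row_mx_eq0 n (x : R) (w : 'rV_n) : w != 0 -> row_mx x%:M w != 0.
Proof.
apply: contraNneq => /(congr1 (@rsubmx _ _ _ _)).
by rewrite row_mxKr linear0 => ->.
Qed.

(* The minimiser of [x |-> qform S (row_mx x%:M w)]. *)
Definition schur_lift n (S : 'M[R]_(1 + n)) (w : 'rV_n) : 'rV_(1 + n) :=
  row_mx (- ((S 0 0)^-1 * (ursubmx S *m w^T) 0 0))%:M w.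

Lemma qform_schur_lift n (S : 'M[R]_(1 + n)) w :
  posdef S -> qform S (schur_lift S w) = qform (schur S) w.
Proof.
move=> Spd; rewrite qform_schur ?gt_eqF ?posdef00 //; last by case: Spd.
by rewrite addNr expr0n mulr0 add0r.
Qed.

Lemma qform_schur_le n (S : 'M[R]_(1 + n)) x w :
  posdef S -> qform (schur S) w <= qform S (row_mx x%:M w).
Proof.
move=> Spd; have S0 := posdef00 Spd; case: Spd => Ssym _.
by rewrite qform_schur ?gt_eqF// lerDr mulr_ge0 ?sqr_ge0// ltW.
Qed.

Lemma posdef_schur n (S : 'M[R]_(1 + n)) : posdef S -> posdef (schur S).
Proof.
move=> Spd; split; first by apply: schur_sym; case: Spd.
move=> v v0; rewrite -(qform_schur_lift v Spd).
by case: Spd => _; apply; exact: row_mx_eq0.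
Qed.

Lemma posdef_det n (S : 'M[R]_n) : posdef S -> 0 < \det S.
Proof.
elim: n S => [S _|n IH S Spd]; first by rewrite det_mx00.
rewrite (@det_schur n) ?gt_eqF ?posdef00 ?mulr_gt0 ?posdef00 ?IH//.
exact: posdef_schur.
Qed.

(** A zero [v] of a nonnegative form minimises it. Along [v + c *: w] with [w = v *m N] the form is
    [c ^+ 2 * q + 2 * c * p], where [p] is the sum of the squares of [w]; some negative [c] makes
    this negative unless [w = 0]. *)
Lemma psd_eq0 n (N : 'M[R]_n) v :
    N^T = N -> (forall w, 0 <= qform N w) -> qform N v = 0 -> v *m N = 0.
Proof.
move=> Nsym Npsd Nv; pose w := v *m N; pose p := (w *m w^T) 0 0.
have pE : p = \sum_i w 0 i ^+ 2.
  by rewrite /p mxE; apply: eq_bigr => i _; rewrite [w^T _ _]mxE expr2.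
have [w0 //|w0] := eqVneq w 0.
have p0 : 0 < p.
  rewrite lt_neqAle pE sumr_ge0 ?andbT; last by move=> i _; exact: sqr_ge0.
  apply: contra_neq w0 => /esym/psumr_eq0P => w0; apply/rowP => i.
  apply/eqP; rewrite [X in _ == X]mxE -sqrf_eq0; apply/eqP/w0 => // j _.
  exact: sqr_ge0.
have q0 := Npsd w; set q := qform N w in q0 *.
(* The exact minimiser would be [- p / q]; the added 1 covers [q = 0]. *)
pose c := - p / (q + 1).
have := Npsd (v + c *: w).
rewrite qformD// Nv qformZ add0r linearZ/= -scalemxAr mxE -/p -/q.
have -> : c ^+ 2 * q + (c * p) *+ 2 = - (p ^+ 2 * (q + 2) / (q + 1) ^+ 2).
  by rewrite /c; field; rewrite gt_eqF//; lra.
rewrite oppr_ge0 leNgt divr_gt0// ?mulr_gt0 ?exprn_gt0//; lra.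
Qed.


Lemma continuous_sum (T : topologicalType) n (F : 'I_n -> T -> R) :
  (forall i, continuous (F i)) -> continuous (fun x => \sum_i F i x).
Proof. by move=> cF; apply: continuous_big => //; exact: add_continuous. Qed.

Lemma continuous_qform n (S : 'M[R]_n) : continuous (qform S : 'rV[R]_n -> R).
Proof.
have -> : qform S = fun v => \sum_j (\sum_i v 0 i * S i j) * v 0 j.
  by apply/funext => w; exact: qformE.
apply: (@continuous_sum 'rV[R]_n n (fun j v => (\sum_i v 0 i * S i j) * v 0 j)).
move=> j; have cs : continuous (fun v : 'rV[R]_n => \sum_i v 0 i * S i j).
  apply: (@continuous_sum 'rV[R]_n n (fun i v => v 0 i * S i j)) => i v.
  apply: continuousM; last exact: cst_continuous.
  exact: (@coord_continuous R 1 n 0 i v).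
move=> v; apply: continuousM; first exact: cs.
exact: (@coord_continuous R 1 n 0 j v).
Qed.

(* The eigenvector maximises the Rayleigh quotient on the unit sphere. *)
Lemma common_eigenvector n (S T : 'M[R]_n.+1) :
    posdef S -> T^T = T ->
  exists (v : 'rV_n.+1) mu, v != 0 /\ v *m T = mu *: (v *m S).
Proof.
move=> [Ssym Spos] Tsym.
(* This is the sphere of the maximum norm; it serves as well as the Euclidean one, since the
   quotient is invariant under scaling. *)
pose A := [set v : 'rV[R]_n.+1 | `|v| = 1].
have unitA (w : 'rV[R]_n.+1) : w != 0 -> A (`|w|^-1 *: w).
  move=> w0; rewrite /A/= normrZ ger0_norm ?invr_ge0// mulVf//.
  by rewrite normr_eq0.
have A0 : A !=set0.
  exists (`|delta_mx 0 0 : 'rV[R]_n.+1|^-1 *: delta_mx 0 0); apply: unitA.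
  apply/eqP => /matrixP/(_ 0 0); rewrite !mxE eqxx => /eqP.
  by rewrite oner_eq0.
have An0 v : A v -> v != 0.
  by move=> Av; rewrite -normr_eq0 Av oner_eq0.
have cA : compact A.
  apply: bounded_closed_compact.
    exists 1; split; first exact: num_real.
    by move=> x x1 v; rewrite /A/= => ->; exact: ltW.
  have -> : A = (fun v : 'rV[R]_n.+1 => `|v|) @^-1` [set 1] by [].
  apply: closed_comp; last exact: closed_eq.
  by move=> v _; exact: norm_continuous.
have [|v] := @EVT_max_rV R n.+1 (fun v => qform T v / qform S v) A A0 cA.
  apply: continuous_in_subspaceT => v; rewrite inE => /An0 v0.
  apply: continuousM; first exact: continuous_qform.
  by apply: continuousV; [rewrite gt_eqF ?Spos|exact: continuous_qform].
rewrite inE => /An0 v0; set mu := _ / _ => vmax.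
exists v, mu; split => //.
(* By maximality of [mu] the form of [mu *: S - T] is nonnegative, and it vanishes at [v], so
   [psd_eq0] applies. *)
suff : v *m (mu *: S - T) = 0.
  by rewrite mulmxBr -scalemxAr => /eqP; rewrite subr_eq0 => /eqP.
have NE w : qform (mu *: S - T) w = mu * qform S w - qform T w.
  by rewrite /qform mulmxBr mulmxBl -scalemxAr -scalemxAl !mxE.
apply: psd_eq0; first by rewrite linearB linearZ/= Ssym Tsym.
- move=> w; have [->|w0] := eqVneq w 0; first by rewrite /qform !mul0mx mxE.
  rewrite NE subr_ge0 -ler_pdivrMr ?Spos//.
  have /vmax : `|w|^-1 *: w \in A by rewrite inE; exact: unitA.
  rewrite !qformZ invfM mulrACA divff ?mul1r// expf_neq0// invr_neq0//.
  by rewrite normr_eq0.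
- by rewrite NE /mu divfK ?subrr// gt_eqF// Spos.
Qed.

(** Completes [v], up to scale, to a basis. In the rank factorisation of the single row [v] the
    column factor is a nonzero scalar and the middle factor selects the first row of
    [row_ebase v]. *)
Lemma unitmx_row n (v : 'rV[R]_(1 + n)) : v != 0 ->
  exists (U : 'M[R]_(1 + n)) c, U \in unitmx /\ row 0 U = c *: v.
Proof.
move=> v0; exists (row_ebase v), (col_ebase v 0 0)^-1.
split; first exact: row_ebase_unit.
have c0 : col_ebase v 0 0 != 0.
  by have := col_ebase_unit v; rewrite unitmxE det_mx11 unitfE.
apply: (scalerI c0); rewrite scalerA divff// scale1r -[RHS]mulmx_ebase.
rewrite [col_ebase v]mx11_scalar rank_rV v0 mxE eqxx mulr1n.
rewrite -mulmxA mul_scalar_mx; congr (_ *: _).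
rewrite rowE; congr (_ *m _).
by apply/rowP => j; rewrite !mxE; case: j => -[].
Qed.

(* Induction on the dimension: a common eigenvector of the pair [(S, T)] gives
   both forms the same [schur_lift], through which the hypothesis passes to the
   Schur complements. *)
Theorem det_log_convex n (S T M : 'M[R]_n) (t : R) :
    posdef S -> posdef T -> posdef M ->
    (forall v, v != 0 ->
      ln (qform M v) <= t * ln (qform S v) + (1 - t) * ln (qform T v)) ->
  ln (\det M) <= t * ln (\det S) + (1 - t) * ln (\det T).
Proof.
elim: n S T M => [|n IH] S T M Spd Tpd Mpd STM.
  by rewrite !det_mx00 ln1 !mulr0 addr0.
have [v [mu [v0 vTS]]] := common_eigenvector Spd Tpd.1.
have [U [c [Uu Uv]]] := @unitmx_row n v v0.
(* A congruence by [U] adds the same constant to all three logarithms; as the weights [t] and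
   [1 - t] sum to 1, the claim is unaffected. *)
have detU (N : 'M[R]_n.+1) : posdef N ->
    ln (\det (U *m N *m U^T)) = ln (\det U ^+ 2) + ln (\det N).
  move=> Npd; rewrite -lnM ?posrE ?posdef_det//; last first.
    by rewrite exprn_even_gt0//= -unitfE -unitmxE.
  by rewrite !det_mulmx det_tr mulrAC expr2.
suff : ln (\det (U *m M *m U^T)) <=
    t * ln (\det (U *m S *m U^T)) + (1 - t) * ln (\det (U *m T *m U^T)).
  by rewrite !detU//; lra.
have S'pd := posdef_congr Uu Spd.
have T'pd := posdef_congr Uu Tpd.
have M'pd := posdef_congr Uu Mpd.
have STM' w : w != 0 -> ln (qform (U *m M *m U^T) w) <=
    t * ln (qform (U *m S *m U^T) w) + (1 - t) * ln (qform (U *m T *m U^T) w).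
  move=> w0; rewrite !qform_congr STM//; apply: contraNneq w0 => wU0.
  by rewrite -(mulmxK Uu w) wU0 mul0mx.
(* The eigenvector is now, up to scale, the first basis vector, so the first rows are
   proportional. *)
have ST' : row 0 (U *m T *m U^T) = mu *: row 0 (U *m S *m U^T).
  rewrite !row_mul Uv -!scalemxAl vTS !scalemxAl scalerA mulrC -scalerA.
  by rewrite -scalemxAl.
move: (U *m S *m U^T) (U *m T *m U^T) (U *m M *m U^T) S'pd T'pd M'pd STM' ST'.
clear S T M vTS detU STM Spd Tpd Mpd => S T M Spd Tpd Mpd STM ST.
have T00 : T 0 0 = mu * S 0 0 by have /rowP/(_ 0) := ST; rewrite !mxE.
have liftE w : @schur_lift n T w = @schur_lift n S w.
  have mu0 : mu != 0.
    by apply: contraTneq (posdef00 Tpd) => m0; rewrite T00 m0 mul0r ltxx.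
  rewrite /schur_lift T00; congr (row_mx (- _)%:M _).
  have -> : ursubmx (T : 'M[R]_(1 + n)) = mu *: ursubmx (S : 'M[R]_(1 + n)).
    apply/matrixP => i j; have /rowP/(_ (rshift 1 j)) := ST.
    by rewrite !mxE !ord1 (_ : lshift n 0 = 0)//; exact/val_inj.
  by rewrite -scalemxAl mxE; field; rewrite mu0 gt_eqF// posdef00.
have S0 := @posdef00 n _ Spd; have T0 := @posdef00 n _ Tpd.
have M0 := @posdef00 n _ Mpd.
have Ss := @posdef_schur n _ Spd; have Ts := @posdef_schur n _ Tpd.
have Ms := @posdef_schur n _ Mpd.
rewrite !(@det_schur n) ?gt_eqF// !lnM ?posrE ?posdef_det//.
(* The hypothesis at the first basis vector settles the corner entries; the Schur complements
   remain. *)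
have : ln (M 0 0) <= t * ln (S 0 0) + (1 - t) * ln (T 0 0).
  have e0 (N : 'M[R]_n.+1) : N 0 0 = qform N (delta_mx 0 0).
    by rewrite /qform -rowE trmx_delta -colE !mxE.
  rewrite !e0; apply: STM; apply/eqP => /matrixP/(_ 0 0).
  by rewrite !mxE eqxx => /eqP; rewrite oner_eq0.
suff : ln (\det (@schur n M)) <=
    t * ln (\det (@schur n S)) + (1 - t) * ln (\det (@schur n T)) by lra.
apply: IH => // w w0.
(* At the common lift [S] and [T] attain their Schur values exactly, while [M] only dominates its
   own, which is the direction required. *)
rewrite -(qform_schur_lift w Spd) -(qform_schur_lift w Tpd) liftE.
apply: le_trans (STM _ (row_mx_eq0 _ w0)).
rewrite ler_ln ?posrE; first exact: qform_schur_le.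
- by case: Ms => _; exact.
- by case: Mpd => _; apply; exact: row_mx_eq0.
Qed.

End QuadraticForm.

(** * Convexity on an interval from explicit derivatives *)

Section ConvexOnSegment.
Local Open Scope convex_scope.
Context {R : realType}.

Lemma conv_lmodE (E : lmodType R) (x y : convex_lmodType E) (t : {i01 R}) :
  x <| t |> y = (t%:num *: (x : E) + (1 - t%:num) *: (y : E)).
Proof. by []. Qed.

Lemma conv_realE (a b : R^o) (t : {i01 R}) :
  a <| t |> b = t%:num * a + (1 - t%:num) * b.
Proof. by []. Qed.

(** Differentiability up to the endpoints supplies continuity there; inside, [f1] agrees with
    ['D_1 f] near each point, so [f2] is also the derivative of ['D_1 f]. *)
Lemma second_derivative_convex_itv (f f1 f2 : R -> R) (a b : R) (t : {i01 R}) :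
    a <= b ->
    (forall x, a <= x <= b -> is_derive x 1 f (f1 x)) ->
    (forall x, a < x < b -> is_derive x 1 f1 (f2 x)) ->
    (forall x, a < x < b -> 0 <= f2 x) ->
  f ((a : R^o) <| t |> (b : R^o)) <= (f a : R^o) <| t |> (f b : R^o).
Proof.
move=> ab ff1 f1f2 f20.
have fc x : a <= x <= b -> {for x, continuous f}.
  move=> /ff1 [df _]; exact/differentiable_continuous/derivable1_diffP.
have Df x : a < x < b -> \forall y \near x, f1 y = 'D_1 f y.
  move=> axb; have : \forall y \near x, y \in `]a, b[.
    by apply: near_in_itvoo; rewrite in_itv.
  apply: filterS => y; rewrite in_itv/= => /andP[ay yb].
  by have [|_ ->] := ff1 y; rewrite ?ltW.
have DDf x : a < x < b -> is_derive x 1 ('D_1 f) (f2 x).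
  by move=> axb; exact: near_eq_is_derive (Df x axb) (f1f2 x axb).
apply: second_derivative_convex => //.
- by move=> x /[dup] axb /DDf[_ ->]; exact: f20.
- by apply/cvg_at_left_filter/fc; rewrite ab lexx.
- by apply/cvg_at_right_filter/fc; rewrite ab lexx.
- move=> x; rewrite in_itv/= => /andP[ax xb].
  by have [|] := ff1 x; rewrite ?ltW.
- by move=> x; rewrite in_itv/= => /DDf[].
Qed.

(** The second derivative of [ln g] is [(g2 * g - g1 ^+ 2) / g ^+ 2]. *)
Lemma ln_convex_itv (g g1 g2 : R -> R) (a b : R) (t : {i01 R}) :
    a <= b ->
    (forall x, a <= x <= b -> is_derive x 1 g (g1 x)) ->
    (forall x, a <= x <= b -> is_derive x 1 g1 (g2 x)) ->
    (forall x, a <= x <= b -> 0 < g x) ->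
    (forall x, a <= x <= b -> g1 x ^+ 2 <= g2 x * g x) ->
  ln (g ((a : R^o) <| t |> (b : R^o))) <=
    (ln (g a) : R^o) <| t |> (ln (g b) : R^o).
Proof.
move=> ab gg1 g1g2 g0 gg2.
have itvW x : a < x < b -> a <= x <= b by move=> /andP[/ltW-> /ltW->].
apply: (@second_derivative_convex_itv (fun x => ln (g x))
  (fun x => g1 x / g x) (fun x => (g2 x * g x - g1 x ^+ 2) / g x ^+ 2)) => //.
- move=> x axb; have gx := gg1 x axb; have lx := is_derive1_ln (g0 x axb).
  by apply: is_derive_eq; rewrite /GRing.scale/= mulrC.
- move=> x /itvW axb; have gx := gg1 x axb; have g1x := g1g2 x axb.
  have gn0 : g x != 0 by rewrite gt_eqF ?g0.
  have Vx : is_derive x 1 (fun y => (g y)^-1) (- (g x) ^- 2 *: g1 x).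
    by split; [apply: derivableV => //|rewrite deriveV// derive_val].
  by apply: is_derive_eq; rewrite /GRing.scale/=; field.
- move=> x /itvW axb; rewrite divr_ge0 ?sqr_ge0// subr_ge0.
  exact: gg2.
Qed.
End ConvexOnSegment.

(** * Derivatives along segments and symmetry of the second derivative *)

Section Segments.
Context {R : realType} {H : finHilbertType R}.
Implicit Types (D : set H) (f phi : H -> R) (x y u v : H).

Lemma is_derive_line f x u (t : R) : differentiable f (x + t *: u) ->
  is_derive t 1 (fun s : R => f (x + s *: u)) ('d f (x + t *: u) u).
Proof.
move=> df; have d := @diff_derivable _ _ _ _ _ u df.
have E : (fun h => h^-1 *: (f (x + (h *: 1 + t) *: u) - f (x + t *: u))) =
         (fun h => h^-1 *: (f (h *: u + (x + t *: u)) - f (x + t *: u))).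
  apply/funext => h; congr (_ *: (f _ - _)).
  by rewrite [h *: 1]mulr1 scalerDl addrCA.
split; first by rewrite /derivable E.
by rewrite -deriveE// /derive E.
Qed.

Lemma near_parallelogram x u v (P : set H) : (\forall y \near x, P y) ->
  exists2 h : R, 0 < h & forall s t, 0 <= s <= h -> 0 <= t <= h ->
    P (x + s *: u + t *: v).
Proof.
move=> /nbhs_ballP[e /= e0 eP].
have k0 : 0 < `|u| + `|v| + 1 by rewrite ltr_wpDl// addr_ge0.
(* The added 1 keeps the denominator positive when [u] and [v] vanish, and makes the bound by [e]
   strict. *)
exists (e / (`|u| + `|v| + 1)) => [|s t /andP[s0 sh] /andP[t0 th]].
  by rewrite divr_gt0.
apply: eP; rewrite -ball_normE/= opprD addrA opprD addrA subrr sub0r.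
rewrite -opprD normrN.
rewrite (le_lt_trans (ler_normD _ _))// !normrZ !ger0_norm//.
have := ler_wpM2r (normr_ge0 u) sh; have := ler_wpM2r (normr_ge0 v) th.
have : 0 < e / (`|u| + `|v| + 1) by rewrite divr_gt0.
have : e = e / (`|u| + `|v| + 1) * (`|u| + `|v| + 1) by rewrite divfK// gt_eqF.
move: (e / _) => h; rewrite !mulrDr; lra.
Qed.

Lemma near_segment x u (P : set H) : (\forall y \near x, P y) ->
  exists2 s : R, 0 < s & forall t, 0 <= t <= s -> P (x + t *: u).
Proof.
move=> /(near_parallelogram u 0)[s s0 sP]; exists s => // t ts.
by have := sP t 0 ts; rewrite scale0r addr0 lexx ltW//; apply.
Qed.

Lemma Ck_differentiable k D f x : Ck k.+1 D f -> D x -> differentiable f x.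
Proof. by case=> + _; apply. Qed.

Lemma CkS k D f : Ck k.+1 D f -> Ck k D f.
Proof.
elim: k f => [f [df _] x Dx|k IH f [df ddf]].
  exact/differentiable_continuous/df.
by split => // u; exact/IH/ddf.
Qed.

Lemma Ck_Dn k D phi us : Ck (size us + k)%N D phi -> Ck k D (Dn phi us).
Proof.
elim: us k => [//|u us IH] k; rewrite [size _]/= addSn -addnS => /IH[_]; exact.
Qed.

Lemma Ck_continuous k D f x : Ck k D f -> D x -> {for x, continuous f}.
Proof. by elim: k => [+ Dx|k IH /CkS]; [exact|exact: IH]. Qed.

Lemma is_derive_Dn k D phi us x u (t : R) :
    Ck (size us + k.+1)%N D phi -> D (x + t *: u) ->
  is_derive t 1 (fun s : R => Dn phi us (x + s *: u))
    (Dn phi (u :: us) (x + t *: u)).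
Proof.
by move=> /Ck_Dn C Dx; exact/is_derive_line/(Ck_differentiable C).
Qed.

Lemma MVT_is_derive (f df : R -> R) (h : R) : 0 < h ->
    (forall r, 0 <= r <= h -> is_derive r 1 f (df r)) ->
  exists2 r, 0 <= r <= h & f h - f 0 = df r * h.
Proof.
move=> h0 fdf; have [||r] := @MVT_segment R f df 0 h (ltW h0).
- move=> r; rewrite in_itv/= => /andP[/ltW r0 /ltW rh].
  by apply: fdf; rewrite r0.
- apply: derivable_within_continuous => r; rewrite in_itv/= => /fdf[]; exact.
- by rewrite in_itv/= subr0; exists r.
Qed.

(** Two mean value theorems: along [u] for the increment of [f] by [h *: v], then along [v] for the
    derivative in direction [u]. *)
Lemma second_difference D f x u v (h : R) : Ck 2 D f -> 0 < h ->
    (forall s t, 0 <= s <= h -> 0 <= t <= h -> D (x + s *: u + t *: v)) ->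
  exists s t, [/\ 0 <= s <= h, 0 <= t <= h &
    f (x + h *: u + h *: v) - f (x + h *: u) - (f (x + h *: v) - f x) =
    Dn f [:: v; u] (x + s *: u + t *: v) * h ^+ 2].
Proof.
move=> C h0 Dst.
have hh : 0 <= h <= h by rewrite ltW ?lexx.
have h00 : (0 : R) <= 0 <= h by rewrite lexx ltW.
have [|s sh] := @MVT_is_derive
    (fun s => f (x + h *: v + s *: u) - f (x + s *: u))
    (fun s => Dn f [:: u] (x + h *: v + s *: u) - Dn f [:: u] (x + s *: u))
    h h0.
  move=> s sh; apply: is_deriveB.
    apply: (@is_derive_Dn 1 D f [::] (x + h *: v) u s C).
    by rewrite addrAC; exact: Dst.
  apply: (@is_derive_Dn 1 D f [::] x u s C).
  by have := Dst s 0 sh h00; rewrite scale0r addr0.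
have [|t th] := @MVT_is_derive (fun t => Dn f [:: u] (x + s *: u + t *: v))
    (fun t => Dn f [:: v; u] (x + s *: u + t *: v)) h h0.
  move=> t th; apply: (@is_derive_Dn 0 D f [:: u] (x + s *: u) v t C).
  exact: Dst.
rewrite !scale0r !addr0 ![x + h *: v + _ *: u]addrAC => -> E.
by exists s, t; split=> //; rewrite E expr2 mulrA.
Qed.

(** The second difference is symmetric in the two directions, so each mixed derivative, at some
    point of a small parallelogram, equals the same number. Were they different at [x], continuity
    would keep them on opposite sides of some [m] there. *)
Theorem Dn_symmetric D f x u v : open D -> Ck 2 D f -> D x ->
  Dn f [:: u; v] x = Dn f [:: v; u] x.
Proof.
move=> oD C Dx.
suff le u' v' : Dn f [:: u'; v'] x <= Dn f [:: v'; u'] x.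
  by apply/eqP; rewrite eq_le !le.
rewrite leNgt; apply/negP => lt.
have c a b : {for x, continuous (Dn f [:: a; b])}.
  exact: (Ck_continuous (@Ck_Dn 0 D f [:: a; b] C) Dx).
have [m m1 m2] : exists2 m, Dn f [:: v'; u'] x < m & m < Dn f [:: u'; v'] x.
  by exists ((Dn f [:: v'; u'] x + Dn f [:: u'; v'] x) / 2); lra.
have near_m : \forall y \near x,
    [/\ D y, Dn f [:: v'; u'] y < m & m < Dn f [:: u'; v'] y].
  near=> y; split; near: y.
  - exact: open_nbhs_nbhs.
  - exact: (cvgr_lt _ (c v' u')).
  - exact: (cvgr_gt _ (c u' v')).
have [h h0 hP] := near_parallelogram u' v' near_m.
have [|s [t [sh th E1]]] := @second_difference D f x u' v' h C h0.
  by move=> s t sh th; have [] := hP s t sh th.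
have [|s' [t' [sh' th' E2]]] := @second_difference D f x v' u' h C h0.
  by move=> s' t' sh' th'; have [] := hP t' s' th' sh'; rewrite addrAC.
have [_ lt1 _] := hP s t sh th; have [_ _ lt2] := hP t' s' th' sh'.
rewrite addrAC in lt2.
have h2 : 0 < h ^+ 2 by rewrite exprn_gt0.
have : Dn f [:: v'; u'] (x + s *: u' + t *: v') * h ^+ 2 <
    Dn f [:: u'; v'] (x + s' *: v' + t' *: u') * h ^+ 2.
  by rewrite ltr_pM2r// (lt_trans lt1).
rewrite -E1 -E2 [x + h *: v' + _]addrAC; lra.
Unshelve. all: by end_near. Qed.

Lemma convex_segment D x y (t : R) : @convex_set R H D -> D x -> D y ->
  0 <= t <= 1 -> D (x + t *: (y - x)).
Proof.
move=> cD Dx Dy /andP[t0 t1].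
have := cD y x (Itv01 t0 t1) (mem_set Dy) (mem_set Dx).
rewrite inE; have -> // : x + t *: (y - x) = t *: y + (1 - t) *: x.
by rewrite scalerBr scalerBl scale1r addrCA.
Qed.

End Segments.

(** * Positivity and log-convexity of the second derivative *)

Section VBConvexity.
Context {R : realType} {H : finHilbertType R}.
Variables (D : set H) (phi : H -> R).
Implicit Types (x y u v : H).

(** Otherwise [- phi] would be convex on the segment, contradicting strict convexity of [phi] at the
    midpoint. *)
Lemma strictly_convex_line x v (s : R) :
    strictly_convex_function D phi -> Ck 2 D phi -> v != 0 -> 0 < s ->
    (forall t, 0 <= t <= s -> D (x + t *: v)) ->
  ~ (forall t, 0 < t < s -> Dn phi [:: v; v] (x + t *: v) <= 0).
Proof.
move=> scv C v0 s0 Ds concave.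
have h0 : 0 <= 2^-1 :> R by rewrite invr_ge0.
have h1 : 2^-1 <= 1 :> R by lra.
pose t := Itv01 h0 h1.
have tE : t%:num = 2^-1 :> R by [].
have Dx : D x by have := Ds 0; rewrite scale0r addr0; apply; rewrite lexx ltW.
have Dxs : D (x + s *: v) by apply: Ds; rewrite lexx ltW.
have xs : x != x + s *: v.
  by rewrite -[eqbLHS]addr0 (inj_eq (addrI x)) eq_sym scaler_eq0 gt_eqF.
have t01 : 0 < t%:num < 1 by rewrite tE; lra.
have := scv t t01 x (x + s *: v) (mem_set Dx) (mem_set Dxs) xs.
rewrite ltNge => /negP; apply.
have /(_ t) := @second_derivative_convex_itv R (fun r => - phi (x + r *: v))
  (fun r => - Dn phi [:: v] (x + r *: v))
  (fun r => - Dn phi [:: v; v] (x + r *: v)) 0 s.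
rewrite !conv_realE conv_lmodE tE.
have -> : 2^-1 *: x + (1 - 2^-1) *: (x + s *: v) = x + ((1 - 2^-1) * s) *: v.
  by rewrite scalerDr addrA -scalerDl scalerA subrKC scale1r.
rewrite mulr0 add0r scale0r addr0 => cvx.
suff : - phi (x + ((1 - 2^-1) * s) *: v) <=
    2^-1 * - phi x + (1 - 2^-1) * - phi (x + s *: v) by lra.
apply: cvx; first exact: ltW.
- move=> r r0s; apply: is_deriveN.
  exact: (@is_derive_Dn _ _ 1 D phi [::] x v r C (Ds r r0s)).
- move=> r /andP[r0 rs]; apply: is_deriveN.
  apply: (@is_derive_Dn _ _ 0 D phi [:: v] x v r C); apply: Ds.
  by rewrite !ltW.
- by move=> r r0s; rewrite oppr_ge0 concave.
Qed.

Hypothesis VB : VB_convex D phi.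

Let oD : open D. Proof. by case: VB. Qed.
Let C4 : Ck 4 D phi. Proof. by case: VB. Qed.
Let scv : strictly_convex_function D phi. Proof. by case: VB. Qed.

Let near_D x : D x -> \forall y \near x, D y.
Proof. by move=> Dx; exact: open_nbhs_nbhs. Qed.

Lemma D2_near_gt0 x v : D x -> v != 0 ->
  ~ \forall y \near x, Dn phi [:: v; v] y <= 0.
Proof.
move=> Dx v0 le0.
have [s s0 Ds] := near_segment v (filterI (near_D Dx) le0).
apply: (@strictly_convex_line x v s) => //; first exact/CkS/CkS.
- by move=> t /Ds[].
- move=> t /andP[t0 ts]; have t0s : 0 <= t <= s by rewrite !ltW.
  by have [] := Ds t t0s.
Qed.

Lemma D2_ge0 x v : D x -> v != 0 -> 0 <= Dn phi [:: v; v] x.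
Proof.
move=> Dx v0; rewrite leNgt; apply/negP => neg.
have c : {for x, continuous (Dn phi [:: v; v])}.
  exact: (Ck_continuous (@Ck_Dn _ _ 2 D phi [:: v; v] C4) Dx).
apply: (D2_near_gt0 Dx v0).
near=> y; apply/ltW; near: y; exact: (cvgr_lt _ c).
Unshelve. all: by end_near. Qed.

(** Where the fourth derivative is negative, the defining inequality forces [D^2[v, v] <= 0]. By
    continuity this would hold on a neighbourhood, which [D2_near_gt0] excludes. *)
Lemma D4_ge0 x u v : D x -> v != 0 -> 0 <= Dn phi [:: u; u; v; v] x.
Proof.
move=> Dx v0; rewrite leNgt; apply/negP => neg.
have c : {for x, continuous (Dn phi [:: u; u; v; v])}.
  exact: (Ck_continuous (@Ck_Dn _ _ 0 D phi [:: u; u; v; v] C4) Dx).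
apply: (D2_near_gt0 Dx v0).
near=> y; have Dy : D y by near: y; exact: near_D.
have neg' : Dn phi [:: u; u; v; v] y < 0 by near: y; exact: (cvgr_lt _ c).
rewrite leNgt; apply/negP => pos.
have [_ _ _ _ /(_ y u v Dy)] := VB.
have := sqr_ge0 (Dn phi [:: u; v; v] y).
have := pmulr_llt0 (Dn phi [:: u; u; v; v] y) pos.
by rewrite neg' => neg2; lra.
Unshelve. all: by end_near. Qed.

(* Adding [e] makes sense of the logarithm before [D2] is known to be
   positive definite. *)
Lemma ln_D2_convex x y v (e : R) (t : {i01 R}) :
    D x -> D y -> v != 0 -> 0 <= e ->
    (forall z, D z -> 0 < Dn phi [:: v; v] z + e) ->
  ln (Dn phi [:: v; v] (t%:num *: x + (1 - t%:num) *: y) + e) <=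
  t%:num * ln (Dn phi [:: v; v] x + e) +
  (1 - t%:num) * ln (Dn phi [:: v; v] y + e).
Proof.
move=> Dx Dy v0 e0 pos; pose u := y - x.
have Ds r : 0 <= r <= 1 -> D (x + r *: u).
  by move=> ?; apply: convex_segment => //; case: VB.
have /(_ t) := @ln_convex_itv R (fun r => Dn phi [:: v; v] (x + r *: u) + e)
  (fun r => Dn phi [:: u; v; v] (x + r *: u))
  (fun r => Dn phi [:: u; u; v; v] (x + r *: u)) 0 1.
rewrite !conv_realE scale0r addr0 scale1r mulr0 mulr1 add0r subrKC.
(* The weight [t] falls on the endpoint 0, so the parameter along the segment is [1 - t]. *)
have -> : x + (1 - t%:num) *: u = t%:num *: x + (1 - t%:num) *: y.
  rewrite /u scalerBr addrCA -[X in _ + (X - _)]scale1r -scalerBl subKr.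
  exact: addrC.
apply => // r r01.
- rewrite -[X in is_derive _ _ _ X]addr0; apply: is_deriveD.
  exact: (@is_derive_Dn _ _ 1 D phi [:: v; v] x u r C4 (Ds r r01)).
- exact: (@is_derive_Dn _ _ 0 D phi [:: u; v; v] x u r C4 (Ds r r01)).
- exact/pos/Ds.
(* The constant 3/2 is weakened to 1, and [D4_ge0] absorbs the extra term [D^4 * e]. *)
- have [_ _ _ _ /(_ _ u v (Ds r r01))] := VB.
  have := mulr_ge0 (D4_ge0 u (Ds r r01) v0) e0.
  have := sqr_ge0 (Dn phi [:: u; v; v] (x + r *: u)).
  rewrite mulrDr; lra.
Qed.

(** If [D^2[v, v]] vanished at [x], the bound of [ln_D2_convex] at an interior point of the segment
    would contain [t * ln e], which tends to minus infinity with [e]. Positivity at that point is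
    thus impossible, against [strictly_convex_line]. *)
Lemma D2_gt0 x v : D x -> v != 0 -> 0 < Dn phi [:: v; v] x.
Proof.
move=> Dx v0; rewrite lt_neqAle D2_ge0// andbT; apply/eqP => D2x0.
have [s s0 Ds] := near_segment v (near_D Dx).
apply: (@strictly_convex_line x v s) => //; first exact/CkS/CkS.
move=> r /andP[r0 rs]; rewrite leNgt; apply/negP => D2r.
have Dxs : D (x + s *: v) by apply: Ds; rewrite lexx ltW.
have [l0 l1] : 0 <= 1 - r / s /\ 1 - r / s <= 1.
  by rewrite subr_ge0 gerBl ler_pdivrMr// mul1r divr_ge0 !ltW.
pose t := Itv01 l0 l1.
have tE : t%:num = 1 - r / s by [].
have t0 : 0 < t%:num by rewrite tE subr_gt0 ltr_pdivrMr// mul1r.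
have pE : t%:num *: x + (1 - t%:num) *: (x + s *: v) = x + r *: v.
  rewrite scalerDr addrA -scalerDl subrKC scale1r scalerA tE subKr.
  by rewrite divfK// gt_eqF.
pose a := Dn phi [:: v; v] (x + r *: v).
pose b := Dn phi [:: v; v] (x + s *: v).
(* With [e <= 1] replacing [b + e] by [b + 1], only [t * ln e] still depends on [e]. *)
have key e : 0 < e -> e <= 1 ->
    ln a <= t%:num * ln e + (1 - t%:num) * ln (b + 1).
  move=> e0 e1.
  have pos z : D z -> 0 < Dn phi [:: v; v] z + e.
    by move=> Dz; rewrite ltr_wpDl// D2_ge0.
  have := ln_D2_convex t Dx Dxs v0 (ltW e0) pos.
  rewrite pE -D2x0 add0r -/a -/b => le1.
  have le2 : ln a <= ln (a + e).
    by rewrite ler_ln ?posrE ?lerDl ?ltW// (lt_trans D2r)// ltrDl.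
  have le3 : ln (b + e) <= ln (b + 1).
    rewrite ler_ln ?posrE ?lerD2l ?pos//.
    by rewrite (lt_le_trans (pos _ Dxs))// lerD2l.
  have t1 : 0 <= 1 - t%:num by rewrite tE subKr divr_ge0 ?ltW.
  by have := ler_wpM2l t1 le3; lra.
(* Solves [key] as an equality for [ln e] and subtracts 1, so that [ln e <= c] violates it; the
   minimum with 0 ensures [e <= 1]. *)
pose c := (ln a - (1 - t%:num) * ln (b + 1)) / t%:num - 1.
have := key (expR (Num.min c 0)) (expR_gt0 _).
rewrite expRK -{1}expR0 ler_expR ge_min lexx orbT => /(_ isT).
have : t%:num * Num.min c 0 <= t%:num * c.
  by rewrite ler_pM2l// ge_min lexx.
rewrite {2}/c mulrBr mulrCA divff ?gt_eqF// mulr1; lra.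
Qed.

End VBConvexity.

(** * Gram matrices and the determinant of an endomorphism *)

Section Gram.
Context {R : realType} {H : finHilbertType R}.
Implicit Types (A : 'End(H)) (c : 'rV[R]_(\dim {:H})).

Let e := vbasis {:H}.

Let e_basis : basis_of {:H} e. Proof. exact: vbasisP. Qed.

(** The basis need not be orthonormal, so the matrix of a self-adjoint [A] may fail to be symmetric;
    that of its bilinear form is symmetric. *)
Definition gram A : 'M[R]_(\dim {:H}) := \matrix_(i, j) inner e`_j (A e`_i).

Lemma inner_vecof A v c :
  inner v (A (passmx.vecof e c)) = \sum_i c 0 i * inner v (A e`_i).
Proof.
rewrite /passmx.vecof !linear_sum; apply: eq_bigr => i _.
by rewrite !linearZ.
Qed.

Lemma gram_mxof A : gram A = passmx.mxof e e A *m gram \1%VF.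
Proof.
apply/matrixP => i j; rewrite !mxE -(passmx.vecof_delta e i).
rewrite (passmx.hom_vecof e e_basis) -[passmx.vecof _ _]id_lfunE inner_vecof.
by apply: eq_bigr => k _; rewrite -rowE !mxE.
Qed.

Lemma qform_gram A c :
  qform (gram A) c = inner (passmx.vecof e c) (A (passmx.vecof e c)).
Proof.
rewrite innerC -[passmx.vecof e c in RHS]id_lfunE inner_vecof qformE.
apply: eq_bigr => j _; rewrite mulrC !id_lfunE innerC inner_vecof.
by congr (_ * _); apply: eq_bigr => i _; rewrite mxE.
Qed.

Lemma posdef_gram A :
    (forall u v, inner u (A v) = inner v (A u)) ->
    (forall v, v != 0 -> 0 < inner v (A v)) ->
  posdef (gram A).
Proof.
move=> Asym Apos; split; first by apply/matrixP => i j; rewrite !mxE Asym.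
by move=> c c0; rewrite qform_gram Apos// (passmx.vecof_eq0 e_basis).
Qed.

Lemma posdef_gram1 : posdef (gram \1%VF).
Proof.
by apply: posdef_gram => [u v|v v0]; rewrite !id_lfunE ?inner_gt0// innerC.
Qed.

Lemma det_lfun_gram A : det_lfun A = \det (gram A) / \det (gram \1%VF).
Proof.
rewrite gram_mxof det_mulmx mulfK// gt_eqF// posdef_det//.
exact: posdef_gram1.
Qed.

Lemma det_lfun_gt0 A : posdef (gram A) -> 0 < det_lfun A.
Proof.
move=> Apd; rewrite det_lfun_gram.
exact: divr_gt0 (posdef_det Apd) (posdef_det posdef_gram1).
Qed.

Lemma ln_det_lfun A : posdef (gram A) ->
  ln (det_lfun A) = ln (\det (gram A)) - ln (\det (gram \1%VF)).
Proof.
move=> Apd; rewrite det_lfun_gram.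
exact: ln_div (posdef_det Apd) (posdef_det posdef_gram1).
Qed.

(** The Gram determinant of the identity contributes the same constant to both sides, the weights
    summing to 1, so [det_log_convex] applies. *)
Lemma ln_det_lfun_convex A B C (t : R) :
    posdef (gram A) -> posdef (gram B) -> posdef (gram C) ->
    (forall v, v != 0 -> ln (inner v (C v)) <=
      t * ln (inner v (A v)) + (1 - t) * ln (inner v (B v))) ->
  ln (det_lfun C) <= t * ln (det_lfun A) + (1 - t) * ln (det_lfun B).
Proof.
move=> Apd Bpd Cpd ABC; rewrite !ln_det_lfun//.
have : ln (\det (gram C)) <=
    t * ln (\det (gram A)) + (1 - t) * ln (\det (gram B)).
  apply: det_log_convex => // c c0; rewrite !qform_gram ABC//.
  by rewrite (passmx.vecof_eq0 e_basis).
by move: (ln _) (ln _) (ln _) (ln _) => a b c d; lra.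
Qed.

End Gram.

(** The first conjunct guarantees that on [D] the total [ln] never takes its default value. *)
Theorem corollary2p6 (R : realType) (H : finHilbertType R)
    (D : set H) (phi : H -> R) :
  VB_convex D phi ->
  (forall x, D x -> 0 < det_lfun (hessian phi x)) /\
  @convex_function R H D (volumetric_barrier phi).
Proof.
move=> VB; have [oD cD C4 _ _] := VB.
have C2 : Ck 2 D phi by exact/CkS/CkS.
have hess x u v : D x -> inner v (hessian phi x u) = Dn phi [:: v; u] x.
  by move=> Dx; exact: hessianP Dx C2 u v.
have pd x : D x -> posdef (gram (hessian phi x)).
  move=> Dx; apply: posdef_gram => [u v|v v0]; rewrite !hess//.
    exact: Dn_symmetric oD C2 Dx.
  exact: D2_gt0 VB _ _ Dx v0.
split=> [x /pd|t x y]; first exact: det_lfun_gt0.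
rewrite !inE => Dx Dy; rewrite conv_realE conv_lmodE.
set z := (_ *: x + _).
have Dz : D z by have := cD x y t (mem_set Dx) (mem_set Dy); rewrite inE.
rewrite /volumetric_barrier ![_ * (2^-1 * _)]mulrCA -mulrDr.
rewrite ler_pM2l ?invr_gt0//.
apply: (ln_det_lfun_convex (pd x Dx) (pd y Dy) (pd z Dz)) => v v0.
rewrite (hess z)// (hess x)// (hess y)//.
(* Positivity being settled, [ln_D2_convex] is used with [e = 0]. *)
have pos w : D w -> 0 < Dn phi [:: v; v] w + 0.
  by move=> Dw; rewrite addr0; exact: D2_gt0 VB _ _ Dw v0.
by have := ln_D2_convex VB t Dx Dy v0 (lexx 0) pos; rewrite !addr0.
Qed.
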